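(* There is a uniform constant $d>0$ (independent of $p,\lambda,q,k,n,X$) such that the following holds. Let $X\neq\{0\}$ be a complex Banach space, $1\leq p<\infty$ and $\lambda\geq1$. Then for all $1\leq q\leq\infty$ and all integers $k,n\geq2$, $$A^k_p(B_{\ell^n_q},X,\lambda)\ \leq\ d\,\lambda^{\frac{1}{pk}}\left(k\,\log k\,(k!)^{2\left(1-\frac{1}{\min\{2,q\}}\right)}\,n\right)^{\frac{1}{2k}}\left(\frac1n\right)^{\frac1p+\frac{1}{\max\{2,q\}}-\frac12},$$ with the convention $1/q=0$ for $q=\infty$.
   Context: For $1\leq q<\infty$, $B_{\ell^n_q}=\{z\in\mathbb{C}^n:(\sum_{i=1}^n|z_i|^q)^{1/q}<1\}$, and $B_{\ell^n_\infty}=\{z\in\mathbb{C}^n:\max_i|z_i|<1\}$. $\mathcal{P}^k(B_{\ell^n_q},X)$ is the space of $k$-homogeneous $X$-valued polynomials $f(z)=\sum_{|\alpha|=k}x_\alpha(f)z^\alpha$, $x_\alpha(f)\in X$, and $\|f\|_{B_{\ell^n_q}}=\sup_{z\in B_{\ell^n_q}}\|f(z)\|$. Define $$A^k_p(B_{\ell^n_q},X,\lambda)=\sup\left\{\frac1n\sum_{i=1}^n r_i: r\in\mathbb{R}^n_{\geq0},\ \sum_{|\alpha|=k}\|x_\alpha(f)\|^p r^{p\alpha}\leq\lambda\|f\|^p_{B_{\ell^n_q}}\ \text{ for all } f\in\mathcal{P}^k(B_{\ell^n_q},X)\right\}.$$ *)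

(* Defs.v *)
From mathcomp Require Import all_boot all_order all_algebra.
From mathcomp Require Import all_classical all_reals all_analysis.
From mathcomp Require Import complex.

Set Implicit Arguments.
Unset Strict Implicit.
Unset Printing Implicit Defensive.

Import Order.TTheory GRing.Theory Num.Theory.
Import numFieldNormedType.Exports.

Local Open Scope classical_set_scope.
Local Open Scope ring_scope.

(* Over the scalars [R[i]] the library norm takes values in [R[i]]; it is real
   and nonnegative there, so its real part is the usual real-valued norm. *)
Definition rnorm (R : realType) (V : normedZmodType R[i]) (x : V) : R :=
  complex.Re `|x|.

(* Each entry of a multi-index of length k is at most k, so that multi-indices
   of length k form a finite type. *)
Definition multi_index (n k : nat) : Type :=
  {a : {ffun 'I_n -> 'I_k.+1} | (\sum_(i < n) (a i : nat))%N == k}.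

Definition mi_entry (n k : nat) (a : multi_index n k) (i : 'I_n) : nat :=
  val a i.

(* A k-homogeneous X-valued polynomial in n variables is represented by its
   family of coefficients, which the polynomial function [heval f] determines. *)
Definition hpoly (n k : nat) (X : Type) : Type := {ffun multi_index n k -> X}.

Definition heval (R : realType) (X : normedModType R[i]) (n k : nat)
    (f : hpoly n k X) (z : 'rV[R[i]]_n) : X :=
  \sum_(a : multi_index n k) (\prod_(i < n) z 0 i ^+ mi_entry a i) *: f a.

(* Only used for 1 <= q; the value at -oo is irrelevant. *)
Definition lq_norm (R : realType) (n : nat) (q : \bar R) (z : 'rV[R[i]]_n) : R :=
  match q with
  | q'%:E => (\sum_(i < n) rnorm (z 0 i) `^ q') `^ q'^-1
  | +oo%E => \big[Num.max/0]_(i < n) rnorm (z 0 i)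
  | -oo%E => 0
  end.

Definition lq_ball (R : realType) (n : nat) (q : \bar R) : set 'rV[R[i]]_n :=
  [set z | lq_norm q z < 1].

Definition ball_norm (R : realType) (X : normedModType R[i]) (n k : nat)
    (q : \bar R) (f : hpoly n k X) : \bar R :=
  ereal_sup [set (rnorm (heval f z))%:E | z in lq_ball q].

(* [powR] satisfies 0 `^ 0 = 1, so a zero entry of the multi-index contributes
   the factor 1, even when the corresponding radius is 0. *)
Definition bohr_radii (R : realType) (X : normedModType R[i]) (n k : nat)
    (p : R) (q : \bar R) (lambda : R) : set 'rV[R]_n :=
  [set r | (forall i, 0 <= r 0 i) /\
    forall f : hpoly n k X,
      ((\sum_(a : multi_index n k)
          rnorm (f a) `^ p * \prod_(i < n) r 0 i `^ (p * (mi_entry a i)%:R))%:E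
       <= lambda%:E * (ball_norm q f) `^ p)%E].

Arguments bohr_radii {R} X n k p q lambda.

Definition arith_bohr (R : realType) (X : normedModType R[i]) (n k : nat)
    (p : R) (q : \bar R) (lambda : R) : \bar R :=
  ereal_sup [set (n%:R^-1 * \sum_(i < n) r 0 i)%:E
            | r in bohr_radii X n k p q lambda].

Arguments arith_bohr {R} X n k p q lambda.

(* The extended-real inverse satisfies +oo^-1 = 0, hence 1/q = 0 at q = +oo. *)
Definition inv_min2 (R : realType) (q : \bar R) : R :=
  fine ((Order.min 2%:E q)^-1)%E.

Definition inv_max2 (R : realType) (q : \bar R) : R :=
  fine ((Order.max 2%:E q)^-1)%E.

(* Main.v *)
Require Import Defs.
From mathcomp Require Import all_boot all_order all_algebra.
From mathcomp Require Import all_classical all_reals all_analysis.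
From mathcomp Require Import complex perm.
From mathcomp Require Import ring lra.

Set Implicit Arguments.
Unset Strict Implicit.
Unset Printing Implicit Defensive.

Import Order.TTheory GRing.Theory Num.Theory.
Import numFieldNormedType.Exports.

Local Open Scope ring_scope.

(** The test polynomial is [P(z) = \sum_a e_a (k!/a!) z^a x] with signs [e_a],
    [x <> 0].  By the multinomial theorem its left-hand side in the definition
    of the Bohr radii dominates [|x|^p (\sum_i r_i^p)^k], so the power mean
    inequality bounds the arithmetic mean of [r] by
    [n^(-1/p) lambda^(1/(p k)) (|P| / |x|)^(1/k)].  The [k]-th root absorbs every
    factor [C^k] or polynomial in [k], so a crude random choice of signs
    suffices.  Put [Q = min(2, q)]; for [q > 2] the ball of l_q lies in
    [n^(1/2 - 1/q)] times the ball of l_2.  [P] is the diagonal of the [k]-linear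
    form with coefficients [e_(type i)], and the sup of a linear functional over
    the l_Q ball is attained up to a constant on a set of at most [64^n] points
    (quarter-turn phases, moduli in [n^(-1/Q)] times the positive integers).
    Replacing the arguments one at a time leaves a union bound over [64^(n k)]
    points.  At each of them Hölder's inequality on the classes of equal type,
    which have at most [k!] elements, bounds the variance of the random sum by
    [(4^k (k!)^(1 - 1/Q))^2]. *)

(** * The real-valued norm over the complex scalars *)

Lemma normr_rnorm (R : realType) (V : normedZmodType R[i]) (x : V) :
  `|x| = (rnorm x)%:C%C.
Proof.
have := normr_ge0 x; rewrite lecE /= => /andP[/eqP im _].
by rewrite /rnorm; move: im; case: `|x| => a b /= ->.
Qed.

Lemma rnorm_ge0 (R : realType) (V : normedZmodType R[i]) (x : V) :
  0 <= rnorm x.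
Proof. by have := normr_ge0 x; rewrite lecE /= => /andP[]. Qed.

Lemma rnorm0 (R : realType) (V : normedZmodType R[i]) : rnorm (0 : V) = 0.
Proof. by rewrite /rnorm normr0. Qed.

Lemma rnorm_gt0 (R : realType) (V : normedZmodType R[i]) (x : V) :
  x <> 0 -> 0 < rnorm x.
Proof.
move=> x0; rewrite lt_neqAle rnorm_ge0 andbT eq_sym; apply/eqP => h; apply: x0.
by apply: normr0_eq0; rewrite normr_rnorm h.
Qed.

Lemma ler_rnormD (R : realType) (V : normedZmodType R[i]) (x y : V) :
  rnorm (x + y) <= rnorm x + rnorm y.
Proof.
by have := ler_normD x y; rewrite !normr_rnorm -rmorphD lecE /= => /andP[].
Qed.

Lemma ler_rnorm_sum (R : realType) (V : normedZmodType R[i]) (I : Type)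
    (s : seq I) (P : pred I) (F : I -> V) :
  rnorm (\sum_(i <- s | P i) F i) <= \sum_(i <- s | P i) rnorm (F i).
Proof.
apply: (big_rec2 (fun a b => rnorm a <= b)) => [|i b a _ h]; first by rewrite rnorm0.
by apply: le_trans (ler_rnormD _ _) _; rewrite lerD2l.
Qed.

Lemma rnormZ (R : realType) (X : normedModType R[i]) (c : R[i]) (x : X) :
  rnorm (c *: x) = rnorm c * rnorm x.
Proof.
by rewrite [LHS]/rnorm normrZ !normr_rnorm -rmorphM.
Qed.

Lemma rnormM (R : realType) (x y : R[i]) : rnorm (x * y) = rnorm x * rnorm y.
Proof. by rewrite [LHS]/rnorm normrM !normr_rnorm -rmorphM. Qed.

Lemma rnorm_prod (R : realType) (I : finType) (F : I -> R[i]) :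
  rnorm (\prod_i F i) = \prod_i rnorm (F i).
Proof.
apply: (big_morph (@rnorm R R[i]) (@rnormM R)).
by rewrite /rnorm normr1.
Qed.

Lemma rnormC (R : realType) (a : R) : rnorm (a%:C : R[i])%C = `|a|.
Proof. by rewrite /rnorm normc_def /= expr0n /= addr0 sqrtr_sqr. Qed.

Lemma rnorm_i (R : realType) : rnorm ('i%C : R[i]) = 1.
Proof. by rewrite /rnorm normc_def /= expr0n expr1n add0r sqrtr1. Qed.

Lemma rnorm_le_ReIm (R : realType) (z : R[i]) :
  rnorm z <= `|complex.Re z| + `|complex.Im z|.
Proof.
rewrite {1}(complexE z); apply: le_trans (ler_rnormD _ _) _.
by rewrite rnormM rnorm_i mul1r !rnormC.
Qed.

Lemma Re_le_rnorm (R : realType) (z : R[i]) : complex.Re z <= rnorm z.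
Proof.
rewrite /rnorm normc_def /=; apply: le_trans (ler_norm _) _.
by rewrite -sqrtr_sqr ler_wsqrtr// lerDl sqr_ge0.
Qed.

Lemma Re_sqr_le_rnorm (R : realType) (z : R[i]) :
  complex.Re z ^+ 2 <= rnorm z ^+ 2.
Proof.
rewrite /rnorm normc_def /= sqr_sqrtr ?addr_ge0 ?sqr_ge0//.
by rewrite lerDl sqr_ge0.
Qed.

Lemma Im_sqr_le_rnorm (R : realType) (z : R[i]) :
  complex.Im z ^+ 2 <= rnorm z ^+ 2.
Proof.
rewrite /rnorm normc_def /= sqr_sqrtr ?addr_ge0 ?sqr_ge0//.
by rewrite lerDr sqr_ge0.
Qed.

(** * Real inequalities: exponential moments and power means *)

(** Exponential moment of a random sign, with 2 in place of the sharp 1/2 in the exponent, so that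
    [1 + x <= expR x] suffices: it gives [2 / (1 - x ^+ 2)] for small [x], while [x <= 2 * x ^+ 2]
    once [x >= 1/2]. *)
Lemma expR_cosh_bound (R : realType) (x : R) :
  expR x + expR (- x) <= 2 * expR (2 * x ^+ 2).
Proof.
wlog x0 : x / 0 <= x => [h|].
  case: (leP 0 x) => [/h//|x0].
  by rewrite addrC -{2}(opprK x) -(sqrrN x); apply: h; lra.
case: (ltP x (1/2)) => hx.
  have e1 : expR x <= (1 - x)^-1.
    rewrite -[expR x]invrK -expRN lef_pV2 ?posrE ?expR_gt0; try lra.
    by have := expR_ge1Dx (- x); lra.
  have e2 : expR (- x) <= (1 + x)^-1.
    rewrite expRN lef_pV2 ?posrE ?expR_gt0; try lra.
    by have := expR_ge1Dx x; lra.
  have e3 : 1 + 2 * x ^+ 2 <= expR (2 * x ^+ 2) by exact: expR_ge1Dx.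
  apply: (@le_trans _ _ (2 * (1 + 2 * x ^+ 2))); last lra.
  apply: (le_trans (lerD e1 e2)).
  rewrite (_ : (1 - x)^-1 + (1 + x)^-1 = 2 / (1 - x ^+ 2)); last first.
    by field; apply/and3P; split; apply/eqP; nra.
  have y0 : 0 <= x ^+ 2 by exact: sqr_ge0.
  have y1 : x ^+ 2 <= 1 / 4 by nra.
  move: (x ^+ 2) y0 y1 => y y0 y1.
  rewrite ler_pdivrMr; last lra.
  nra.
have h1 : expR x <= expR (2 * x ^+ 2) by rewrite ler_expR; nra.
have h2 : expR (- x) <= expR (2 * x ^+ 2) by rewrite ler_expR; nra.
lra.
Qed.

(** Young's inequality for the product [y * 1] with exponents [p] and [p / (p - 1)], multiplied by
    [p]; the conjugate exponent degenerates at [p = 1], which is treated apart. *)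
Lemma bernoulli_powR (R : realType) (p y : R) :
  1 <= p -> 0 <= y -> p * (y - 1) + 1 <= y `^ p.
Proof.
move=> p1 y0; case: (eqVneq p 1) => [->|pn].
  by rewrite powRr1//; lra.
have p1' : 1 < p by rewrite lt_neqAle eq_sym pn.
have pp : 0 < p / (p - 1) by rewrite divr_gt0; lra.
have := @conjugate_powR R y 1 p (p / (p - 1)) y0 ler01 _ pp.
rewrite powR1 mulr1 => /(_ ltac:(lra)).
have -> : p^-1 + (p / (p - 1))^-1 = 1.
  by field; apply/andP; split; apply/eqP; lra.
move=> /(_ erefl) h.
have pr : 0 < p by lra.
rewrite -(ler_pM2l pr) in h.
have e : p * (y `^ p / p + 1 / (p / (p - 1))) = y `^ p + (p - 1).
  by field; apply/andP; split; apply/eqP; lra.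
by move: h; rewrite e; lra.
Qed.

(** Bernoulli's inequality is applied to each [y i] divided by the mean [m]; the linear terms then
    cancel in the sum. *)
Lemma power_mean (R : realType) (I : finType) (A : {pred I}) (y : I -> R)
    (p : R) :
  1 <= p -> (forall i, 0 <= y i) -> (0 < #|A|)%N ->
  ((\sum_(i in A) y i) / #|A|%:R) `^ p <= (\sum_(i in A) y i `^ p) / #|A|%:R.
Proof.
move=> p1 y0 A0; set m := _ / _.
have N0 : 0 < #|A|%:R :> R by rewrite ltr0n.
have m0 : 0 <= m by rewrite divr_ge0 ?sumr_ge0.
case: (eqVneq m 0) => [->|mn].
  by rewrite powR0 ?divr_ge0 ?sumr_ge0 ?ler0n// => [*|]; [exact: powR_ge0|apply/eqP; lra].
have mp : 0 < m by rewrite lt_neqAle eq_sym mn.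
rewrite ler_pdivlMr//.
have -> : \sum_(i in A) y i `^ p = \sum_(i in A) m `^ p * (y i / m) `^ p.
  apply: eq_bigr => i _; have yim : 0 <= y i / m by exact: divr_ge0.
  rewrite -powRM//.
  by congr (_ `^ _); field.
rewrite -mulr_sumr ler_pM2l ?powR_gt0//.
apply: (@le_trans _ _ (\sum_(i in A) (p * (y i / m - 1) + 1))); last first.
  by apply: ler_sum => i _; apply: bernoulli_powR => //; exact: divr_ge0.
rewrite big_split /= -mulr_sumr sumrB -mulr_suml.
rewrite (_ : (\sum_(i in A) y i) = m * #|A|%:R); last first.
  by rewrite /m divfK// gt_eqF.
by rewrite mulrAC divff// mul1r sumr_const subrr mulr0 add0r.
Qed.

(** Each [y i] is at most [M], so one factor [y i] is kept and the remaining power [t - 1] is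
    bounded by that of [M]. *)
Lemma sum_powR_le (R : realType) (I : finType) (y : I -> R) (t M : R) :
  1 <= t -> (forall i, 0 <= y i) -> \sum_i y i <= M ->
  \sum_i y i `^ t <= M `^ t.
Proof.
move=> t1 y0 hM.
have le1 i : y i <= M.
  apply: le_trans hM; rewrite (bigD1 i)//= lerDl; exact: sumr_ge0.
have M0 : 0 <= M by apply: le_trans hM; exact: sumr_ge0.
have tp : 0 < t by lra.
apply: (@le_trans _ _ (\sum_i y i * M `^ (t - 1))).
  apply: ler_sum => i _; rewrite -(mulr_powRB1 (y0 i) tp).
  apply: ler_wpM2l => //; apply: ge0_ler_powR; rewrite ?nnegrE//; lra.
by rewrite -mulr_suml -(mulr_powRB1 M0 tp) ler_wpM2r// powR_ge0.
Qed.

(** * Random signs by exponential moments and a union bound *)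

(** In the exponential moment method, [expR (T ^+ 2)] pays for the two-sided union bound over [S]
    and [expR (2 * T ^+ 2)] for the moment of a single sum, whence the factor 3. *)
Lemma signs_real (R : realType) (A I : finType) (S : {pred I})
    (x : I -> A -> R) (T s : R) :
  0 < T -> 0 < s -> (forall i, i \in S -> \sum_a x i a ^+ 2 <= s ^+ 2) ->
  2 * #|S|%:R <= expR (T ^+ 2) ->
  exists e : {ffun A -> bool},
    forall i, i \in S -> `|\sum_a (-1) ^+ e a * x i a| <= 3 * T * s.
Proof.
move=> T0 s0 hx hS.
pose X i (e : {ffun A -> bool}) := \sum_a (-1) ^+ e a * x i a.
(* This choice makes [t ^+ 2 * s ^+ 2] equal to [T ^+ 2]. *)
pose t := T / s.
pose W e := \sum_(i in S) (expR (t * X i e) + expR (- (t * X i e))).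
have avg u i : \sum_e expR (u * X i e) =
    \prod_a (expR (u * x i a) + expR (- (u * x i a))).
  transitivity (\sum_(e : {ffun A -> bool})
      \prod_a expR (u * ((-1) ^+ e a * x i a))).
    by apply: eq_bigr => e _; rewrite /X mulr_sumr expR_sum.
  (* Independence of the signs: the sum over all sign patterns factorizes over [a]. *)
  rewrite -(bigA_distr_bigA (fun a (b : bool) => expR (u * ((-1) ^+ b * x i a)))).
  apply: eq_bigr => a _; rewrite big_bool /= addrC expr0 mul1r expr1 mulN1r.
  by rewrite mulrN.
have bnd u i : i \in S -> u ^+ 2 = t ^+ 2 ->
    \sum_e expR (u * X i e) <= 2 ^+ #|A| * expR (2 * T ^+ 2).
  move=> iS ut; rewrite avg.
  apply: (@le_trans _ _ (\prod_(a : A) (2 * expR (2 * (u * x i a) ^+ 2)))).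
    apply: ler_prod => a _; rewrite addr_ge0 ?expR_ge0//=.
    exact: expR_cosh_bound.
  rewrite big_split /= prodr_const -expR_sum ler_wpM2l ?exprn_ge0// ler_expR.
  rewrite -mulr_sumr ler_wpM2l//.
  under eq_bigr do rewrite exprMn ut.
  rewrite -mulr_sumr.
  apply: le_trans (ler_wpM2l (sqr_ge0 _) (hx _ iS)) _.
  by rewrite -exprMn /t divfK// gt_eqF.
have tot : \sum_e W e <= \sum_(e : {ffun A -> bool}) expR (3 * T ^+ 2).
  rewrite /W exchange_big /= sumr_const card_ffun card_bool.
  apply: (@le_trans _ _ (\sum_(i in S) 2 * (2 ^+ #|A| * expR (2 * T ^+ 2)))).
    apply: ler_sum => i iS; rewrite big_split /=.
    have := bnd t i iS erefl.
    have := bnd (- t) i iS (sqrrN t).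
    have -> : \sum_e expR (- t * X i e) = \sum_e expR (- (t * X i e)).
      by apply: eq_bigr => e _; rewrite mulNr.
    lra.
  rewrite sumr_const -[_ *+ #|S|]mulr_natr -[_ *+ (2 ^ _)]mulr_natr natrX.
  rewrite (_ : 3 * T ^+ 2 = T ^+ 2 + 2 * T ^+ 2); last by ring.
  rewrite expRD.
  rewrite (_ : _ * #|S|%:R = 2 * #|S|%:R * (expR (2 * T ^+ 2) * 2 ^+ #|A|));
    last by ring.
  by rewrite -[leRHS]mulrA ler_wpM2r// mulr_ge0 ?expR_ge0 ?exprn_ge0.
(* Some pattern does not exceed the average; the strict comparison of sums needs an actual pattern,
   here the constant one. *)
have [e he] : exists e, W e <= expR (3 * T ^+ 2).
  apply/not_existsP => h; move: tot; apply/negP; rewrite -ltNge.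
  apply: ltr_sum => [|e _].
    by apply/hasP; exists [ffun => true]; rewrite ?mem_index_enum.
  by rewrite ltNge; apply/negP/h.
exists e => i iS.
have ge0 j b : 0 <= expR (t * X j b) + expR (- (t * X j b)).
  by rewrite addr_ge0 ?expR_ge0.
have {}he : expR (t * X i e) + expR (- (t * X i e)) <= expR (3 * T ^+ 2).
  apply: le_trans he; rewrite /W (bigD1 i)//= lerDl.
  by apply: sumr_ge0 => j _; exact: ge0.
have t0 : 0 < t by rewrite divr_gt0.
have h1 : t * X i e <= 3 * T ^+ 2.
  by rewrite -ler_expR; apply: le_trans he; rewrite lerDl expR_ge0.
have h2 : - (t * X i e) <= 3 * T ^+ 2.
  by rewrite -ler_expR; apply: le_trans he; rewrite lerDr expR_ge0.
have e3 : t * (3 * T * s) = 3 * T ^+ 2 by rewrite /t; field; rewrite gt_eqF.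
rewrite -/(X i e) ler_norml; apply/andP; split; rewrite -(ler_pM2l t0).
  by rewrite mulrN e3; lra.
by rewrite e3.
Qed.

(** Real and imaginary parts are separate points, indexed by [I * bool]; this doubles the
    cardinality, and adding the two bounds turns 3 into 6. *)
Lemma signs_complex (R : realType) (A I : finType) (S : {set I})
    (x : I -> A -> R[i]) (T s : R) :
  0 < T -> 0 < s -> (forall i, i \in S -> \sum_a rnorm (x i a) ^+ 2 <= s ^+ 2) ->
  4 * #|S|%:R <= expR (T ^+ 2) ->
  exists e : {ffun A -> bool},
    forall i, i \in S -> rnorm (\sum_a (-1) ^+ e a * x i a) <= 6 * T * s.
Proof.
move=> T0 s0 hx hS.
pose y (w : I * bool) a :=
  if w.2 then complex.Re (x w.1 a) else complex.Im (x w.1 a).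
have [||e he] := @signs_real R A _ (finset.setX S [set: bool]) y T s T0 s0.
- move=> [i b]; rewrite inE /= => /andP[iS _]; apply: le_trans (hx i iS).
  apply: ler_sum => a _; rewrite /y /=.
  by case: b; [exact: Re_sqr_le_rnorm|exact: Im_sqr_le_rnorm].
- by rewrite cardsX cardsT card_bool natrM; lra.
exists e => i iS; apply: le_trans (rnorm_le_ReIm _) _.
have sgn a : (-1) ^+ e a * x i a = ((-1) ^+ e a)%:C%C * x i a.
  by rewrite rmorphXn rmorphN rmorph1.
have hre := he (i, true); have him := he (i, false).
rewrite !inE /= iS /y /= in hre him.
have reE : complex.Re (\sum_a (-1) ^+ e a * x i a) =
    \sum_a (-1) ^+ e a * complex.Re (x i a).
  rewrite raddf_sum; apply: eq_bigr => a _; rewrite sgn.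
  by case: (x i a) => u v /=; ring.
have imE : complex.Im (\sum_a (-1) ^+ e a * x i a) =
    \sum_a (-1) ^+ e a * complex.Im (x i a).
  rewrite raddf_sum; apply: eq_bigr => a _; rewrite sgn.
  by case: (x i a) => u v /=; ring.
rewrite reE imE; have := hre isT; have := him isT; lra.
Qed.

(** * Index maps, their types and the multinomial theorem *)

Lemma sum_fiber_card n k (f : {ffun 'I_k -> 'I_n}) :
  (\sum_(i < n) ([ffun i => inord #|[pred j | f j == i]|]
     : {ffun 'I_n -> 'I_k.+1}) i)%N == k.
Proof.
apply/eqP; rewrite -[RHS](card_ord k) -sum1_card.
rewrite (partition_big (fun j => f j) xpredT)//=.
apply: eq_bigr => i _; rewrite ffunE inordK ?sum1_card//.
by rewrite ltnS (leq_trans (max_card _))// card_ord.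
Qed.

(** The exponent of the monomial [\prod_j z (f j)]. Fibres of [f] have at most [k] elements, so
    [inord] returns their exact size. *)
Definition index_type n k (f : {ffun 'I_k -> 'I_n}) : multi_index n k :=
  exist (fun a : {ffun 'I_n -> 'I_k.+1} => (\sum_(i < n) (a i : nat))%N == k)
    _ (sum_fiber_card f).

Lemma mi_entry_index_type n k (f : {ffun 'I_k -> 'I_n}) i :
  mi_entry (index_type f) i = #|[pred j | f j == i]|.
Proof.
by rewrite /mi_entry /= ffunE inordK// ltnS (leq_trans (max_card _))// card_ord.
Qed.

Lemma prod_index_type (S : comPzRingType) n k (z : 'I_n -> S)
    (f : {ffun 'I_k -> 'I_n}) :
  \prod_j z (f j) = \prod_i z i ^+ mi_entry (index_type f) i.
Proof.
rewrite (partition_big (fun j => f j) xpredT)//=.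
apply: eq_bigr => i _; rewrite mi_entry_index_type -prodr_const.
by apply: eq_bigr => j /eqP ->.
Qed.

(** The coefficient [k!/a!], encoded as a count of index maps so that it appears when the terms of
    an expanded product are grouped by type. *)
Definition multinomial n k (a : multi_index n k) : nat :=
  #|[pred f : {ffun 'I_k -> 'I_n} | index_type f == a]|.

Lemma multinomial_theorem (S : comPzRingType) n k (y : 'I_n -> S) :
  (\sum_i y i) ^+ k =
  \sum_(a : multi_index n k) (multinomial a)%:R * \prod_i y i ^+ mi_entry a i.
Proof.
rewrite -[in LHS](card_ord k) -prodr_const bigA_distr_bigA.
rewrite (partition_big (@index_type n k) xpredT)//=.
apply: eq_bigr => a _; rewrite mulr_natl -sumr_const.
by apply: eq_bigr => f /eqP <-; rewrite prod_index_type.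
Qed.

(* Two index maps of the same type differ by a permutation of ['I_k]. *)
Lemma multinomial_le_fact n k (a : multi_index n k) : (multinomial a <= k`!)%N.
Proof.
case: (pickP [pred f : {ffun 'I_k -> 'I_n} | index_type f == a]); last first.
  by move=> h; rewrite /multinomial (eq_card0 h).
move=> g /eqP ga.
pose h (s : {perm 'I_k}) : {ffun 'I_k -> 'I_n} := [ffun j => g (s j)].
apply: (@leq_trans #|h @: [set: {perm 'I_k}]|); last first.
  by apply: leq_trans (leq_imset_card _ _) _; rewrite cardsT card_Sn.
apply: subset_leq_card; apply/fintype.subsetP => f /eqP fa.
have : perm_eq [tuple f j | j < k] [tuple g j | j < k].
  apply/allP => i _ /=; apply/eqP.
  have cnt (u : {ffun 'I_k -> 'I_n}) : count_mem i [tuple u j | j < k] =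
      mi_entry (index_type u) i.
    rewrite mi_entry_index_type -sum1_card -sum1_count big_map /=.
    by rewrite big_enum_cond; apply: eq_bigl => j; rewrite inE.
  by rewrite !cnt fa ga.
case/tuple_permP => s hs; apply/imsetP; exists s => //.
apply/ffunP => j; rewrite ffunE.
have := congr1 (fun u => nth (f j) u j) hs.
by rewrite -!tnth_nth !tnth_mktuple.
Qed.

(** * A finite norming set for the ball of l_Q *)

Definition quarter_turn (R : realType) (c : bool * bool) : R[i] :=
  (-1) ^+ c.1 * (if c.2 then 'i%C else 1).

Definition net_point (R : realType) n (Q : R)
    (w : {ffun 'I_n -> bool * bool * 'I_(4 * n)}) (i : 'I_n) : R[i] :=
  quarter_turn R (w i).1 * ((w i).2.+1%:R / n%:R `^ Q^-1)%:C%C.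

(** The moduli of the corresponding points have sum of [Q]-th powers at most 4; enlarging the unit
    ball in this way leaves room for rounding moduli up. *)
Definition net (R : realType) n (Q : R) :=
  [set w : {ffun 'I_n -> bool * bool * 'I_(4 * n)} |
    \sum_i ((w i).2.+1%:R : R) `^ Q <= 4 * n%:R].

Lemma rnorm_quarter_turn (R : realType) c : rnorm (quarter_turn R c) = 1.
Proof.
have s1 : rnorm ((-1) ^+ c.1 : R[i]) = 1 by rewrite /rnorm normr_sign.
rewrite /quarter_turn rnormM s1 mul1r.
by case: c.2; rewrite ?rnorm_i// /rnorm normr1.
Qed.

Lemma rnorm_net_point (R : realType) n (Q : R) w i :
  rnorm (@net_point R n Q w i) = (w i).2.+1%:R / n%:R `^ Q^-1.
Proof.
by rewrite /net_point rnormM rnorm_quarter_turn mul1r rnormC ger0_norm.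
Qed.

Lemma net_point_lq (R : realType) n (Q : R) w :
  (0 < n)%N -> 1 <= Q -> w \in net n Q ->
  \sum_i rnorm (@net_point R n Q w i) `^ Q <= 4.
Proof.
move=> n0 Q1; rewrite inE => hw.
have nR : 0 < n%:R :> R by rewrite ltr0n.
rewrite (eq_bigr (fun i => ((w i).2.+1%:R : R) `^ Q / n%:R)) => [|i _].
  by rewrite -mulr_suml ler_pdivrMr.
rewrite rnorm_net_point powRM ?invr_ge0 ?powR_ge0//; congr (_ * _).
rewrite -powRN -powRrM mulNr mulVf ?powR_inv1// ?(ltW nR)//.
by rewrite gt_eqF//; lra.
Qed.

(** A weighted count: on the net the numbers [(w i).2] sum to at most [3 * n], so the product of the
    weights [F] is at least 1. Summed over all [w] it factorizes into [n] geometric series, each at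
    most 4 * 8 * 2 = 64, the 4 counting the phases. *)
Lemma card_net (R : realType) n (Q : R) : 1 <= Q -> (#|net n Q| <= 64 ^ n)%N.
Proof.
move=> Q1; rewrite -(ler_nat R) natrX -sum1_card natr_sum.
pose F (i : 'I_n) (u : bool * bool * 'I_(4 * n)) : R := 8 * (2^-1) ^+ u.2.
have F0 i u : 0 <= F i u by rewrite mulr_ge0// exprn_ge0// invr_ge0.
apply: (@le_trans _ _ (\sum_(w : {ffun 'I_n -> bool * bool * 'I_(4 * n)})
    \prod_i F i (w i))).
  rewrite big_mkcond; apply: ler_sum => w _; case: ifPn; last first.
    by move=> _; apply: prodr_ge0.
  rewrite inE => hw.
  have hs : (\sum_i (w i).2 <= 3 * n)%N.
    have : \sum_i ((w i).2.+1%:R : R) <= 4 * n%:R.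
      apply: le_trans hw; apply: ler_sum => i _.
      by apply: le1r_powR => //; rewrite ler1n.
    have -> : \sum_i ((w i).2.+1%:R : R) = \sum_i ((w i).2%:R + 1).
      by apply: eq_bigr => i _; rewrite natr1.
    rewrite big_split /= sumr_const card_ord -natr_sum -(ler_nat R) natrM.
    lra.
  rewrite big_split /= prodr_const card_ord prodrXr.
  rewrite exprVn ler_pdivlMr ?exprn_gt0// mul1r.
  have -> : (8 : R) ^+ n = 2 ^+ (3 * n) by rewrite exprM; congr (_ ^+ _); ring.
  by rewrite ler_eXn2l// ltr1n.
rewrite -bigA_distr_bigA /=.
rewrite -[X in _ <= _ ^+ X](card_ord n) -prodr_const.
apply: ler_prod => i _; rewrite sumr_ge0//=.
have -> : \sum_u F i u =
    \sum_(c : bool * bool) \sum_(j < 4 * n) 8 * (2^-1 : R) ^+ j.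
  by rewrite pair_big; apply: eq_bigr => -[].
rewrite sumr_const card_prod card_bool -mulr_sumr.
have := @subrX1 R 2^-1 (4 * n).
have : 0 <= (2^-1 : R) ^+ (4 * n) by rewrite exprn_ge0// invr_ge0.
by move: (\sum_(i < _) _) => s h1 h2; rewrite -mulr_natr; lra.
Qed.

(** The real or the imaginary part carries at least half of the modulus, and a sign makes it
    positive; multiplication by ['i] puts minus the imaginary part in the real place. *)
Lemma exists_quarter_turn (R : realType) (b : R[i]) :
  exists c, rnorm b / 2 <= complex.Re (quarter_turn R c * b).
Proof.
have h := rnorm_le_ReIm b.
have sgn (r : R) : exists s : bool, `|r| = (-1) ^+ s * r.
  case: (leP 0 r) => hr.
    by exists false; rewrite expr0 mul1r ger0_norm.
  by exists true; rewrite expr1 mulN1r ltr0_norm.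
have [hR|hR] := leP (rnorm b / 2) `|complex.Re b|.
  have [s hs] := sgn (complex.Re b); exists (s, false); rewrite /quarter_turn /=.
  apply: le_trans hR _; rewrite hs; case: b {h hs} => u v.
  by case: s => /=; lra.
have hI : rnorm b / 2 <= `|complex.Im b| by lra.
have [s hs] := sgn (- complex.Im b); exists (s, true); rewrite /quarter_turn /=.
apply: le_trans hI _; rewrite -normrN hs; case: b {h hR hs} => u v.
by case: s => /=; lra.
Qed.

Lemma powR_addr1_le (R : realType) (x Q : R) :
  0 <= x -> 1 <= Q <= 2 -> (x + 1) `^ Q <= 2 * (x `^ Q + 1).
Proof.
move=> x0 /andP[Q1 Q2].
have := @power_mean R bool predT (fun b => if b then x else 1) Q Q1.
have -> : #|(predT : {pred bool})| = 2 by rewrite card_bool.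
rewrite !big_bool /= powR1.
move=> /(_ _ isT) h; rewrite (_ : x + 1 = 2 * ((x + 1) / 2)); last by field.
rewrite powRM//; last by rewrite divr_ge0// addr_ge0.
have q4 : 2 `^ Q <= 4 :> R.
  have -> : 4 = 2 `^ 2%:R :> R by rewrite powR_mulrn//; ring.
  by apply: ler_powR => //; rewrite ler1n.
have := powR_ge0 x Q; have := powR_ge0 2 Q.
have := powR_ge0 ((x + 1) / 2) Q.
have hh : ((x + 1) / 2) `^ Q <= (x `^ Q + 1) / 2 by apply: h => -[].
nra.
Qed.

(** Rescale [z] so that its [Q]-th power sum is at most [n], round each modulus up to a positive
    integer, and choose the phase that makes the real part of the [i]-th term at least half its
    modulus. Rounding up only increases these terms, and [powR_addr1_le] keeps the power sum below
    [4 * n]. *)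
Lemma net_norming (R : realType) n (Q M : R) (z b : 'I_n -> R[i]) :
  (0 < n)%N -> 1 <= Q <= 2 -> 0 < M -> \sum_i rnorm (z i) `^ Q <= M `^ Q ->
  exists2 w, w \in net n Q &
    rnorm (\sum_i z i * b i) <= 2 * M * rnorm (\sum_i net_point Q w i * b i).
Proof.
move=> n0 Q12 M0 hz; have /andP[Q1 Q2] := Q12.
have Q0 : 0 < Q by lra.
have nR : 0 < n%:R :> R by rewrite ltr0n.
pose r := n%:R `^ Q^-1 : R.
have r0 : 0 < r by rewrite powR_gt0.
have rQ : r `^ Q = n%:R by rewrite /r -powRrM mulVf ?gt_eqF// powRr1// ltW.
pose x i := r * rnorm (z i) / M.
have x0 i : 0 <= x i by rewrite divr_ge0 ?mulr_ge0 ?rnorm_ge0// ltW.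
have sx : \sum_i x i `^ Q <= n%:R.
  rewrite (eq_bigr (fun i => n%:R / M `^ Q * rnorm (z i) `^ Q)); last first.
    move=> i _; rewrite /x powRM ?invr_ge0 ?mulr_ge0 ?rnorm_ge0 ?(ltW r0) ?(ltW M0)//.
    rewrite powRM ?rnorm_ge0 ?(ltW r0)// rQ.
    rewrite -powR_inv1 ?(ltW M0)// -powRrM mulN1r powRN; ring.
  rewrite -mulr_sumr mulrAC ler_pdivrMr ?powR_gt0//.
  by rewrite ler_pM2l.
(* This keeps the integer parts below [4 * n], as the type of the net demands. *)
have xn i : x i <= n%:R.
  have [x1|x1] := leP (x i) 1; first by apply: le_trans x1 _; rewrite ler1n.
  apply: le_trans sx; apply: le_trans (le1r_powR (ltW x1) Q1) _.
  by rewrite (bigD1 i)//= lerDl sumr_ge0// => *; exact: powR_ge0.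
have tr i : (Num.trunc (x i))%:R <= x i < (Num.trunc (x i)).+1%:R.
  exact: truncn_itv.
have lt4n i : (Num.trunc (x i) < 4 * n)%N.
  apply: (@leq_ltn_trans n); last by rewrite ltn_Pmull.
  by rewrite -(ler_nat R); apply: le_trans (xn i); case/andP: (tr i).
have /choice[c hc] := fun i => exists_quarter_turn (b i).
pose w := [ffun i => (c i, Ordinal (lt4n i))].
have hw : w \in net n Q.
  rewrite inE; apply: (@le_trans _ _ (\sum_i 2 * (x i `^ Q + 1))).
    apply: ler_sum => i _; rewrite ffunE /=.
    apply: le_trans (powR_addr1_le (x0 i) Q12).
    apply: ge0_ler_powR; rewrite ?nnegrE ?addr_ge0 ?ler0n ?(ltW Q0)//.
    by rewrite -natr1 lerD2r; case/andP: (tr i).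
  by rewrite -mulr_sumr big_split /= sumr_const card_ord; lra.
exists w => //.
apply: le_trans (ler_rnorm_sum _ _ _) _.
have hRe : complex.Re (\sum_i net_point Q w i * b i) =
    \sum_i (Num.trunc (x i)).+1%:R / r * complex.Re (quarter_turn R (c i) * b i).
  rewrite raddf_sum; apply: eq_bigr => i _ /=; rewrite /net_point ffunE /=.
  rewrite mulrAC; move: (quarter_turn _ _ * _) => [u v] /=.
  by rewrite -/r; ring.
apply: le_trans (ler_wpM2l _ (Re_le_rnorm _)); last by rewrite mulr_ge0// ltW.
rewrite hRe mulr_sumr; apply: ler_sum => i _.
rewrite rnormM.
have -> : rnorm (z i) = M / r * x i.
  by rewrite /x; field; rewrite !gt_eqF.
have bi := rnorm_ge0 (b i).
have Mr : 0 < M / r by rewrite divr_gt0.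
rewrite (_ : 2 * M * _ = M / r * ((Num.trunc (x i)).+1%:R *
  (2 * complex.Re (quarter_turn R (c i) * b i)))); last by ring.
rewrite -mulrA ler_pM2l//; apply: ler_pM => //.
  by case/andP: (tr i) => _ /ltW.
have := hc i; lra.
Qed.

(** * Reduction of a signed multilinear form to net points *)

Definition sign_form (R : realType) n k
    (e : {ffun {ffun 'I_k -> 'I_n} -> bool}) (Z : 'I_k -> 'I_n -> R[i]) : R[i] :=
  \sum_(f : {ffun 'I_k -> 'I_n}) (-1) ^+ e f * \prod_j Z j (f j).

(* A multilinear form is linear in its [j0]-th argument, so that the sup over
   that argument is attained on [net], up to the factor [2 * M]. *)
Lemma sign_form_norming_step (R : realType) n k e (Q M : R)
    (Z : 'I_k -> 'I_n -> R[i]) (j0 : 'I_k) :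
  (0 < n)%N -> 1 <= Q <= 2 -> 0 < M ->
  \sum_i rnorm (Z j0 i) `^ Q <= M `^ Q ->
  exists2 w, w \in net n Q &
    rnorm (sign_form e Z) <= 2 * M *
      rnorm (sign_form e (fun j => if j == j0 then net_point Q w else Z j)).
Proof.
move=> n0 Q12 M0 hZ.
pose b i : R[i] := \sum_(f : {ffun 'I_k -> 'I_n} | f j0 == i)
  (-1) ^+ e f * \prod_(j | j != j0) Z j (f j).
have lin v : sign_form e (fun j => if j == j0 then v else Z j) =
    \sum_i v i * b i.
  rewrite /sign_form (partition_big (fun f : {ffun 'I_k -> 'I_n} => f j0) xpredT)//=.
  apply: eq_bigr => i _; rewrite /b mulr_sumr; apply: eq_bigr => f /eqP fi.
  rewrite (bigD1 j0)//= eqxx fi mulrCA; congr (_ * (_ * _)).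
  by apply: eq_bigr => j /negbTE ->.
have -> : sign_form e Z = sign_form e (fun j => if j == j0 then Z j0 else Z j).
  apply: eq_bigr => f _; congr (_ * _); apply: eq_bigr => j _.
  by case: eqP => [->|].
have [w hw h] := net_norming b n0 Q12 M0 hZ.
by exists w => //; rewrite !lin.
Qed.

Lemma sign_form_norming (R : realType) n k e (Q M B : R)
    (Z : 'I_k -> 'I_n -> R[i]) :
  (0 < n)%N -> 1 <= Q <= 2 -> 0 < M ->
  (forall j, \sum_i rnorm (Z j i) `^ Q <= M `^ Q) ->
  (forall W : {ffun 'I_k -> {ffun 'I_n -> bool * bool * 'I_(4 * n)}},
    (forall j, W j \in net n Q) ->
    rnorm (sign_form e (fun j => net_point Q (W j))) <= B) ->
  rnorm (sign_form e Z) <= (2 * M) ^+ k * B.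
Proof.
move=> n0 Q12 M0 hZ hB.
(* Induction on the number [s] of slots that are still arbitrary; the slots from [s] on already hold
   net points. *)
suff h s (Y : 'I_k -> 'I_n -> R[i])
    (W : 'I_k -> {ffun 'I_n -> bool * bool * 'I_(4 * n)}) : (s <= k)%N ->
    (forall j : 'I_k, if (j < s)%N then is_true (\sum_i rnorm (Y j i) `^ Q <= M `^ Q)
      else W j \in net n Q /\ Y j = net_point Q (W j)) ->
    rnorm (sign_form e Y) <= (2 * M) ^+ s * B.
  have n4 : (0 < 4 * n)%N by rewrite muln_gt0.
  (* At [s = k] no slot holds a net point yet, so the family [W] is a dummy. *)
  apply: (h k Z (fun=> [ffun i => (false, false, Ordinal n4)])) => // j.
  by rewrite ltn_ord.
elim: s Y W => [|s IH] Y W sk hY.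
  rewrite expr0 mul1r.
  have -> : Y = (fun j => net_point Q ([ffun j => W j] j)).
    by apply/funext => j; have [_] := hY j; rewrite ffunE.
  by apply: hB => j; rewrite ffunE; have [] := hY j.
have := hY (Ordinal sk); rewrite /= ltnSn => hs.
have [w hw h] := sign_form_norming_step e n0 Q12 M0 hs.
apply: le_trans h _; rewrite exprS -[leRHS]mulrA ler_wpM2l ?mulr_ge0 ?(ltW M0)//.
apply: (IH _ (fun j => if j == Ordinal sk then w else W j)); first exact: ltnW.
move=> j; case: eqP => [->|/eqP jne]; first by rewrite /= ltnn.
have := hY j; rewrite ltnS leq_eqVlt.
by rewrite (_ : (j == s :> nat) = false)//; apply/negbTE.
Qed.

(** * Variance bound over the classes of equal type *)

(** Hölder's inequality against the constant 1; the empty set is separate because [power_mean]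
    divides by the cardinality. *)
Lemma power_mean_sum (R : realType) (I : finType) (A : {pred I}) (y : I -> R)
    (Q : R) :
  1 <= Q -> (forall i, 0 <= y i) ->
  \sum_(i in A) y i <=
    #|A|%:R `^ (1 - Q^-1) * (\sum_(i in A) y i `^ Q) `^ Q^-1.
Proof.
move=> Q1 y0; have Q0 : 0 < Q by lra.
have [A0|A0] := posnP #|A|.
  by rewrite big_pred0 ?mulr_ge0 ?powR_ge0//; exact/card0_eq.
have N0 : 0 < #|A|%:R :> R by rewrite ltr0n.
have S0 : 0 <= \sum_(i in A) y i by exact: sumr_ge0.
have W0 : 0 <= \sum_(i in A) y i `^ Q by apply: sumr_ge0 => *; exact: powR_ge0.
have h := power_mean Q1 y0 A0.
have := @ge0_ler_powR R Q^-1 _ _ _ _ _ h.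
rewrite -powRrM mulfV ?gt_eqF// powRr1 ?divr_ge0// => {}h.
have {}h := h _ _ _.
rewrite powRB ?(gt_eqF N0) ?implybT// powRr1 ?ler0n// mulrAC -mulrA.
rewrite -ler_pdivrMl//; rewrite mulrC; apply: le_trans (h _ _ _) _.
- by rewrite invr_ge0 ltW.
- by rewrite nnegrE powR_ge0.
- by rewrite nnegrE divr_ge0.
rewrite powRM ?invr_ge0//.
by rewrite -[X in _ * X `^ _]powR_inv1// -powRrM mulN1r powRN.
Qed.

Definition type_sum (R : realType) n k (g : {ffun 'I_k -> 'I_n} -> R[i])
    (a : multi_index n k) : R[i] :=
  \sum_(f in [pred f | index_type f == a]) g f.

(** Hölder on a class of at most [k!] maps bounds its sum by its [Q]-th power sum [w a]. These add
    up to at most [4 ^+ k], and since [2 / Q >= 1], [sum_powR_le] controls the sum of their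
    powers. *)
Lemma type_sum_sqr (R : realType) n k (Q : R)
    (Y : 'I_k -> 'I_n -> R[i]) :
  1 <= Q <= 2 -> (forall j, \sum_i rnorm (Y j i) `^ Q <= 4) ->
  \sum_(a : multi_index n k)
    rnorm (type_sum (fun f => \prod_j Y j (f j)) a) ^+ 2 <=
  (4 ^+ k * (k`!)%:R `^ (1 - Q^-1)) ^+ 2.
Proof.
move=> /andP[Q1 Q2] hY; have Q0 : 0 < Q by lra.
pose g (f : {ffun 'I_k -> 'I_n}) := \prod_j rnorm (Y j (f j)).
have g0 f : 0 <= g f by apply: prodr_ge0 => *; exact: rnorm_ge0.
pose w (a : multi_index n k) :=
  \sum_(f in [pred f : {ffun 'I_k -> 'I_n} | index_type f == a]) g f `^ Q.
have w0 a : 0 <= w a by apply: sumr_ge0 => *; exact: powR_ge0.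
have gQ f : g f `^ Q = \prod_j rnorm (Y j (f j)) `^ Q.
  (* Nonnegativity is carried through the induction because [powRM] asks for it. *)
  suff [] : 0 <= g f /\ g f `^ Q = \prod_j rnorm (Y j (f j)) `^ Q by [].
  rewrite /g; apply: (big_ind2 (fun u v : R => 0 <= u /\ u `^ Q = v)).
  - by rewrite powR1.
  - by move=> u _ u' _ [u0 <-] [u0' <-]; rewrite powRM// mulr_ge0.
  - by move=> j _; rewrite rnorm_ge0.
have sw : \sum_a w a <= 4 ^+ k.
  rewrite (_ : \sum_a w a = \sum_(f : {ffun 'I_k -> 'I_n}) g f `^ Q); last first.
    by rewrite (partition_big (@index_type n k) xpredT).
  under eq_bigr do rewrite gQ.
  rewrite -(bigA_distr_bigA (fun j i => rnorm (Y j i) `^ Q)).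
  rewrite -[X in _ <= _ ^+ X](card_ord k) -prodr_const.
  apply: ler_prod => j _; rewrite hY andbT.
  by apply: sumr_ge0 => *; exact: powR_ge0.
have tQ : 1 <= 2 * Q^-1 by rewrite ler_pdivlMr// mul1r.
have F0 : 0 <= (k`!)%:R `^ (1 - Q^-1) :> R by exact: powR_ge0.
apply: (@le_trans _ _
    (\sum_a ((k`!)%:R `^ (1 - Q^-1)) ^+ 2 * w a `^ (2 * Q^-1))).
  apply: ler_sum => a _.
  have -> : w a `^ (2 * Q^-1) = (w a `^ Q^-1) ^+ 2.
    by rewrite mulrC powRrM powR_mulrn// powR_ge0.
  rewrite -exprMn ler_pXn2r ?nnegrE ?rnorm_ge0 ?mulr_ge0 ?powR_ge0//.
  apply: le_trans (ler_rnorm_sum _ _ _) _.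
  under eq_bigr do rewrite rnorm_prod.
  apply: le_trans (power_mean_sum _ Q1 g0) _.
  apply: ler_wpM2r; first exact: powR_ge0.
  apply: ge0_ler_powR; rewrite ?nnegrE ?ler0n ?ler_nat//.
    by rewrite subr_ge0 invf_le1.
  exact: multinomial_le_fact.
rewrite -mulr_sumr [leRHS]exprMn mulrC; apply: ler_wpM2r.
  exact: exprn_ge0.
apply: le_trans (sum_powR_le tQ w0 sw) _.
rewrite -[leRHS]powR_mulrn ?exprn_ge0//; apply: ler_powR.
  by rewrite exprn_ege1// ler1n.
by rewrite ler_piMr// invf_le1.
Qed.

(** * Choice of the signs *)

Lemma random_form (R : realType) n k (Q : R) :
  (0 < n)%N -> (0 < k)%N -> 1 <= Q <= 2 ->
  exists e : {ffun multi_index n k -> bool},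
    forall (M : R) (z : 'I_n -> R[i]), 0 < M ->
      \sum_i rnorm (z i) `^ Q <= M `^ Q ->
      rnorm (\sum_(a : multi_index n k) (-1) ^+ e a *
        ((multinomial a)%:R * \prod_i z i ^+ mi_entry a i)) <=
      18 * (8 * M) ^+ k * Num.sqrt (k%:R * n%:R) *
        (k`!)%:R `^ (1 - Q^-1).
Proof.
move=> n0 k0 Q12; have /andP[Q1 Q2] := Q12.
pose I := {ffun 'I_k -> {ffun 'I_n -> bool * bool * 'I_(4 * n)}}.
pose S := [set W : I | [forall j, W j \in net n Q]].
pose x (W : I) (a : multi_index n k) :=
  type_sum (fun f => \prod_j net_point Q (W j) (f j)) a.
(* The 8 comes from 4 * 64^(n k) <= 2^(8 n k), which is at most [expR (T ^+ 2)]. *)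
pose T : R := Num.sqrt (8 * (k * n)%:R).
have kn0 : 0 < (k * n)%:R :> R by rewrite ltr0n muln_gt0 k0.
have T0 : 0 < T by rewrite sqrtr_gt0; lra.
have F0 : 0 < (k`!)%:R `^ (1 - Q^-1) :> R by rewrite powR_gt0// ltr0n fact_gt0.
pose s : R := 4 ^+ k * (k`!)%:R `^ (1 - Q^-1).
have s0 : 0 < s by rewrite mulr_gt0// exprn_gt0.
have SP W : W \in S -> forall j, W j \in net n Q.
  by rewrite inE => /forallP.
have hx W : W \in S -> \sum_a rnorm (x W a) ^+ 2 <= s ^+ 2.
  move=> /SP hW; apply: (type_sum_sqr (Y := fun j => net_point Q (W j))) => // j.
  exact: (net_point_lq n0 Q1 (hW j)).
have cS : 4 * #|S|%:R <= expR (T ^+ 2).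
  have hc : (#|S| <= 64 ^ (n * k))%N.
    have -> : #|S| = (#|net n Q| ^ k)%N.
      rewrite -[X in (_ ^ X)%N](card_ord k) -card_ffun_on; apply: eq_card => W.
      by rewrite inE; apply/forallP/ffun_onP.
    rewrite expnM leq_exp2r//; exact: card_net.
  rewrite sqr_sqrtr; last lra.
  apply: (@le_trans _ _ (expR 1 ^+ (8 * (k * n)))); last first.
    by rewrite -expRM_natl mulr1 natrM.
  apply: (@le_trans _ _ (2 ^+ (8 * (k * n)))); last first.
    rewrite lerXn2r ?nnegrE ?expR_ge0//.
    by have := expR_ge1Dx (1 : R); lra.
  rewrite -natrX -[4]/(4%:R) -natrM ler_nat.
  apply: (@leq_trans (4 ^ (n * k) * 64 ^ (n * k))).
    rewrite leq_mul// -{1}(expn1 4) leq_exp2l//.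
    by rewrite muln_gt0 n0.
  by rewrite -expnMn (mulnC n) (expnM 2 8).
have [e he] := signs_complex T0 s0 hx cS.
exists e => M z M0 hz.
(* Signs depending only on the type make the diagonal of the form equal to the polynomial. *)
pose e' := [ffun f : {ffun 'I_k -> 'I_n} => e (index_type f)].
have formE (Y : 'I_k -> 'I_n -> R[i]) : sign_form e' Y =
    \sum_(a : multi_index n k) (-1) ^+ e a *
      type_sum (fun f => \prod_j Y j (f j)) a.
  rewrite /sign_form (partition_big (@index_type n k) xpredT)//=.
  apply: eq_bigr => a _; rewrite /type_sum mulr_sumr.
  by apply: eq_bigr => f /eqP fa; rewrite ffunE fa.
have -> : \sum_(a : multi_index n k) (-1) ^+ e a *
      ((multinomial a)%:R * \prod_i z i ^+ mi_entry a i) =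
    sign_form e' (fun=> z).
  rewrite formE; apply: eq_bigr => a _; congr (_ * _).
  rewrite mulr_natl -sumr_const.
  by apply: eq_bigr => f /eqP <-; rewrite prod_index_type.
apply: le_trans (sign_form_norming (B := 6 * T * s) n0 Q12 M0 (fun=> hz) _) _.
  by move=> W hW; rewrite formE; apply: he; rewrite inE; apply/forallP.
(* Here 8 is 2 from the norming times 4 from the variance, and 18 = 6 * 3 with 3 bounding the square
   root of 8 in [T]. *)
have -> : 18 * (8 * M) ^+ k * Num.sqrt (k%:R * n%:R) * (k`!)%:R `^ (1 - Q^-1) =
    (2 * M) ^+ k * (6 * (3 * Num.sqrt (k%:R * n%:R)) * s).
  rewrite /s (_ : 8 * M = 2 * M * 4); last by ring.
  rewrite [(2 * M * 4) ^+ k]exprMn; ring.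
apply: ler_wpM2l; first by rewrite exprn_ge0// mulr_ge0// ltW.
apply: ler_wpM2r; first exact: ltW.
apply: ler_wpM2l => //.
have -> : 3 * Num.sqrt (k%:R * n%:R) = Num.sqrt (3 ^+ 2 * (k * n)%:R) :> R.
  by rewrite [RHS]sqrtrM ?sqr_ge0// sqrtr_sqr natrM ger0_norm.
by rewrite ler_wsqrtr//; lra.
Qed.

(** * Balls of l_q inside multiples of balls of l_Q *)

Lemma powRVK (R : realType) (x p : R) : 0 <= x -> p != 0 -> (x `^ p) `^ p^-1 = x.
Proof. by move=> x0 p0; rewrite -powRrM mulfV// powRr1. Qed.

Lemma sum_rnorm_le1 (R : realType) n (q : R) (z : 'rV[R[i]]_n) :
  1 <= q -> lq_norm q%:E z < 1 -> \sum_i rnorm (z 0 i) `^ q <= 1.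
Proof.
move=> q1 /= h; have q0 : 0 < q by lra.
rewrite leNgt; apply/negP => h1; move: h; apply/negP; rewrite -leNgt.
have e1 : 1 = 1 `^ q^-1 :> R by rewrite powR1.
rewrite [leLHS]e1; apply: ge0_ler_powR; rewrite ?nnegrE ?invr_ge0//.
- exact: ltW.
- by apply: sumr_ge0 => *; exact: powR_ge0.
- exact: ltW.
Qed.

(** For [q <= 2] take [Q = q], and the radius is 1. Otherwise [Q = 2]: Hölder with exponent [q / 2]
    for finite [q], and coordinates at most 1 for [q = +oo]. *)
Lemma lq_ball_embedding (R : realType) n (q : \bar R) :
  (0 < n)%N -> (1%:E <= q)%E ->
  exists2 Q : R, 1 <= Q <= 2 /\ Q^-1 = inv_min2 q &
    forall z : 'rV[R[i]]_n, lq_ball q z ->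
      \sum_i rnorm (z 0 i) `^ Q <= (n%:R `^ (2^-1 - inv_max2 q)) `^ Q.
Proof.
move=> n0; have nR : 0 < n%:R :> R by rewrite ltr0n.
have pow2 (z : 'rV[R[i]]_n) i : rnorm (z 0 i) `^ 2 = rnorm (z 0 i) ^+ 2.
  by rewrite powR_mulrn// rnorm_ge0.
case: q => [q| |]//; rewrite ?lee_fin => q1.
- have [q2|q2] := leP q 2.
  + exists q.
      split; first by rewrite q1.
      by rewrite /inv_min2 min_r ?lee_fin// fine_invr.
    move=> z hz; rewrite /inv_max2 max_l ?lee_fin//.
    rewrite fine_invr.
    rewrite subrr powRr0 powR1; exact: sum_rnorm_le1.
  + exists 2.
      split; first by apply/andP; split; lra.
      by rewrite /inv_min2 min_l ?lee_fin ?(ltW q2)// fine_invr.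
    move=> z hz; rewrite /inv_max2 max_r ?lee_fin ?(ltW q2)//.
    rewrite fine_invr.
    have hq : 1 <= q / 2 by lra.
    have q0 : 0 < q by lra.
    have := @power_mean_sum R 'I_n predT (fun i => rnorm (z 0 i) `^ 2) _ hq
      (fun i => powR_ge0 _ _).
    move=> h; apply: (le_trans h).
    rewrite -[leRHS]powRrM.
    have -> : (2^-1 - q^-1) * 2 = 1 - (q / 2)^-1 by field; apply/eqP; lra.
    rewrite -[leRHS]mulr1 card_ord; apply: ler_wpM2l; first exact: powR_ge0.
    have e1 : 1 = 1 `^ (q / 2)^-1 :> R by rewrite powR1.
    rewrite [leRHS]e1.
    apply: ge0_ler_powR; rewrite ?nnegrE ?invr_ge0//.
    * lra.
    * by apply: sumr_ge0 => *; exact: powR_ge0.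
    * apply: le_trans (sum_rnorm_le1 q1 hz); apply: ler_sum => i _.
      by rewrite -powRrM mulrC divfK.
- exists 2.
    split; first by apply/andP; split; lra.
    by rewrite /inv_min2 min_l ?leey// fine_invr.
  move=> z hz; rewrite /inv_max2 max_r ?leey// invey /= subr0.
  rewrite -powRrM mulVf// powRr1 ?ler0n//.
  apply: (@le_trans _ _ (\sum_(i < n) 1)); last by rewrite sumr_const card_ord.
  apply: ler_sum => i _; rewrite pow2 exprn_ile1 ?rnorm_ge0//.
  apply: le_trans (ltW hz); exact: le_bigmax.
Qed.

(** * The test polynomial in the Bohr inequality *)

Definition random_poly (R : realType) (X : normedModType R[i]) n k
    (e : {ffun multi_index n k -> bool}) (x : X) : hpoly n k X :=
  [ffun a => ((-1) ^+ e a * (multinomial a)%:R) *: x].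

Lemma heval_random_poly (R : realType) (X : normedModType R[i]) n k
    (e : {ffun multi_index n k -> bool}) (x : X) (z : 'rV[R[i]]_n) :
  heval (random_poly e x) z =
  (\sum_(a : multi_index n k) (-1) ^+ e a *
    ((multinomial a)%:R * \prod_i z 0 i ^+ mi_entry a i)) *: x.
Proof.
rewrite scaler_suml; apply: eq_bigr => a _; rewrite ffunE scalerA.
by rewrite mulrC -mulrA.
Qed.

Lemma rnorm_random_poly (R : realType) (X : normedModType R[i]) n k
    (e : {ffun multi_index n k -> bool}) (x : X) a :
  rnorm (random_poly e x a) = (multinomial a)%:R * rnorm x.
Proof.
rewrite ffunE rnormZ rnormM; congr (_ * _).
by rewrite {1}/rnorm normr_sign mul1r /rnorm normr_nat -(rmorph_nat (real_complex R)).
Qed.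

Lemma lq_ball0 (R : realType) n (q : \bar R) : (1%:E <= q)%E ->
  lq_ball q (0 : 'rV[R[i]]_n).
Proof.
case: q => [q| |]//; rewrite /lq_ball /= ?lee_fin => q1.
  have q0 : q != 0 by apply/eqP; lra.
  rewrite big1 ?powR0 ?invr_eq0// => i _.
  by rewrite mxE rnorm0 powR0.
by rewrite (big_ind (fun x : R => x < 1))// => [x y|i _];
  rewrite ?mxE ?rnorm0// gt_max => -> ->.
Qed.

(** The Bohr inequality is tested on [random_poly e x]; the norm of [x] cancels, and the multinomial
    theorem for the numbers [r 0 i] to the power [p] sums the left-hand side. *)
Lemma bohr_radii_power_sum (R : realType) (X : normedModType R[i]) n k
    (p lambda B : R) (q : \bar R) (e : {ffun multi_index n k -> bool})
    (x : X) (r : 'rV[R]_n) :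
  1 <= p -> 1 <= lambda -> (1%:E <= q)%E -> 0 <= B -> x <> 0 ->
  (forall z : 'rV[R[i]]_n, lq_ball q z ->
    rnorm (\sum_(a : multi_index n k) (-1) ^+ e a *
      ((multinomial a)%:R * \prod_i z 0 i ^+ mi_entry a i)) <= B) ->
  bohr_radii X n k p q lambda r ->
  (\sum_i r 0 i `^ p) ^+ k <= lambda * B `^ p.
Proof.
move=> p1 l1 q1 B0 x0 hB [r0 hr].
have N0 := rnorm_gt0 x0; have p0 : 0 < p by lra.
have bn : (ball_norm q (random_poly e x) <= (B * rnorm x)%:E)%E.
  apply: ge_ereal_sup => _ [z hz <-]; rewrite lee_fin heval_random_poly rnormZ.
  by rewrite ler_pM2r// hB.
(* The origin lies in the ball; monotonicity of the extended power is stated for nonnegative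
   arguments. *)
have bn0 : (0 <= ball_norm q (random_poly e x))%E.
  apply: ereal_sup_ge; exists (rnorm (heval (random_poly e x) 0))%:E.
    by exists 0 => //; exact: lq_ball0.
  by rewrite lee_fin rnorm_ge0.
have BN : 0 <= B * rnorm x by rewrite mulr_ge0// ltW.
have {}hr := hr (random_poly e x).
have : ((\sum_a rnorm (random_poly e x a) `^ p *
    \prod_(i < n) r 0 i `^ (p * (mi_entry a i)%:R))%:E <=
    (lambda * (B * rnorm x) `^ p)%:E)%E.
  apply: le_trans hr _; rewrite EFinM; apply: lee_wpmul2l.
    by rewrite lee_fin; lra.
  rewrite -poweR_EFin; apply: gt0_ler_poweR => //; first exact: ltW.
    by rewrite in_itv /= bn0 leey.
  by rewrite in_itv /= leey lee_fin BN.
rewrite lee_fin powRM ?(ltW N0)// mulrA => h.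
rewrite -(ler_pM2r (powR_gt0 p N0)); apply: le_trans h.
rewrite multinomial_theorem mulr_suml; apply: ler_sum => a _.
rewrite rnorm_random_poly powRM ?ler0n ?(ltW N0)// mulrAC.
have -> : \prod_i (r 0 i `^ p) ^+ mi_entry a i =
    \prod_i r 0 i `^ (p * (mi_entry a i)%:R).
  by apply: eq_bigr => i _; rewrite powRrM powR_mulrn// powR_ge0.
apply: ler_wpM2r; first by apply: prodr_ge0 => *; exact: powR_ge0.
apply: ler_wpM2r; first exact: powR_ge0.
(* A coefficient is bounded by its [p]-th power: trivially at 0, and from [p >= 1] for positive
   integers. *)
case: (multinomial a) => [|m]; first by rewrite powR_ge0.
by apply: le1r_powR => //; rewrite ler1n.
Qed.

(** * Means, roots and the final constant *)

Lemma mean_le_of_power_sum (R : realType) n k (p L : R) (r : 'I_n -> R) :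
  (0 < n)%N -> (0 < k)%N -> 1 <= p -> (forall i, 0 <= r i) ->
  (\sum_i r i `^ p) ^+ k <= L ->
  n%:R^-1 * \sum_i r i <= (L `^ k%:R^-1 / n%:R) `^ p^-1.
Proof.
move=> n0 k0 p1 r0 h; have p0 : 0 < p by lra.
have nR : 0 < n%:R :> R by rewrite ltr0n.
have S0 : 0 <= \sum_i r i `^ p by apply: sumr_ge0 => *; exact: powR_ge0.
have hS : \sum_i r i `^ p <= L `^ k%:R^-1.
  have kn : k%:R != 0 :> R by rewrite pnatr_eq0 -lt0n.
  rewrite -[leLHS](powRVK S0 kn) powR_mulrn//.
  by apply: ge0_ler_powR; rewrite ?nnegrE ?invr_ge0 ?exprn_ge0// (le_trans _ h)// exprn_ge0.
have m0 : 0 <= n%:R^-1 * \sum_i r i by rewrite mulr_ge0 ?sumr_ge0// invr_ge0 ltW.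
rewrite -[leLHS](powRVK (p := p) m0); last by rewrite gt_eqF.
apply: ge0_ler_powR; rewrite ?nnegrE ?invr_ge0 ?powR_ge0 ?(ltW p0)//.
  by rewrite divr_ge0 ?powR_ge0 ?ler0n.
have cn : #|(predT : {pred 'I_n})| = n by rewrite card_ord.
have := @power_mean R 'I_n predT r p p1 r0; rewrite cn => /(_ n0) hm.
rewrite mulrC; apply: (le_trans hm).
by rewrite ler_pM2r ?invr_gt0.
Qed.

Lemma ln2_ge (R : realType) : 2^-1 <= ln 2 :> R.
Proof.
have h : expR (2^-1) <= 2 :> R.
  have e : 2^-1 <= expR (- 2^-1) :> R by have := expR_ge1Dx (- 2^-1 : R); lra.
  by rewrite -[leLHS]invrK -expRN -[leRHS]invrK lef_pV2 ?posrE ?expR_gt0 ?invr_gt0.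
by rewrite -ler_expR lnK// posrE.
Qed.

(** The [k]-th root leaves 8 from [(8 * M) ^+ k] and at most 36 from the numerical factor, and 36 *
    8 = 288. *)
Lemma root_random_bound (R : realType) n k (M F : R) :
  (2 <= k)%N -> (0 < n)%N -> 0 < M -> 0 < F ->
  (18 * (8 * M) ^+ k * Num.sqrt (k%:R * n%:R) * F) `^ k%:R^-1 <=
  288 * M * (k%:R * ln k%:R * F `^ 2 * n%:R) `^ (2 * k%:R)^-1.
Proof.
move=> k2 n0 M0 F0.
have nR : 0 < n%:R :> R by rewrite ltr0n.
have kR : 2 <= k%:R :> R by rewrite ler_nat.
have lnk : 2^-1 <= ln k%:R :> R.
  by apply: le_trans (ln2_ge R) _; rewrite ler_ln ?posrE; lra.
have V0 : 0 < k%:R * ln k%:R * F `^ 2 * n%:R :> R.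
  by rewrite !mulr_gt0 ?powR_gt0//; lra.
have K0 : (0 : R) <= k%:R^-1 by rewrite invr_ge0; lra.
have K1 : k%:R^-1 <= 1 :> R by rewrite invf_le1; lra.
set V := k%:R * _ * _ * _ in V0 *.
(* Since [4 * ln k%:R >= 1], the logarithm enters under the square root at the cost of a factor 2,
   which turns 18 into 36. *)
apply: (@le_trans _ _ ((36 * (8 * M) ^+ k * V `^ 2^-1) `^ k%:R^-1)).
  apply: ge0_ler_powR; rewrite ?nnegrE//.
  - by rewrite !mulr_ge0 ?exprn_ge0 ?sqrtr_ge0 ?mulr_ge0// ltW.
  - by rewrite !mulr_ge0 ?exprn_ge0 ?powR_ge0 ?mulr_ge0// ltW.
  rewrite -powR12_sqrt ?mulr_ge0//.
  have e : (2 ^+ 2 * V) `^ 2^-1 = 2 * V `^ 2^-1.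
    by rewrite powRM ?sqr_ge0 ?(ltW V0)// powR12_sqrt ?sqr_ge0// sqrtr_sqr ger0_norm.
  have -> : 36 * (8 * M) ^+ k * V `^ 2^-1 =
      18 * (8 * M) ^+ k * (2 ^+ 2 * V) `^ 2^-1 by rewrite e; ring.
  rewrite -mulrA; apply: ler_wpM2l.
    by rewrite mulr_ge0 ?exprn_ge0 ?mulr_ge0// ltW.
  have -> : F = (F `^ 2) `^ 2^-1 by rewrite powRVK// ltW.
  rewrite -powRM ?powR_ge0 ?mulr_ge0//.
  apply: ge0_ler_powR; rewrite ?nnegrE ?invr_ge0 ?mulr_ge0 ?powR_ge0 ?(ltW V0)//.
    by lra.
  have -> : 2 ^+ 2 * V = (k%:R * n%:R * F `^ 2) * (4 * ln k%:R).
    by rewrite /V; ring.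
  by rewrite ler_peMr ?mulr_ge0 ?powR_ge0//; lra.
clearbody V; rewrite !powRM ?mulr_ge0 ?exprn_ge0 ?powR_ge0 ?mulr_ge0 ?(ltW M0)//.
rewrite -[(8 * M) ^+ k]powR_mulrn ?mulr_ge0 ?(ltW M0)// powRVK ?mulr_ge0 ?(ltW M0)//; last first.
  by rewrite gt_eqF//; lra.
rewrite -powRrM -invfM; apply: ler_wpM2r; first exact: powR_ge0.
have : 36 `^ k%:R^-1 <= 36 :> R by apply: ler1_powR; rewrite ?ler1n.
nra.
Qed.

Theorem proposition2p5 (R : realType) :
  exists d : R, 0 < d /\
    forall (X : completeNormedModType R[i]) (p lambda : R) (q : \bar R)
           (k n : nat),
      (exists x : X, x <> 0) ->
      1 <= p -> 1 <= lambda -> (1%:E <= q)%E ->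
      (2 <= k)%N -> (2 <= n)%N ->
      (arith_bohr X n k p q lambda <=
       (d * lambda `^ (p * k%:R)^-1
          * (k%:R * ln k%:R * (k`!)%:R `^ (2 * (1 - inv_min2 q)) * n%:R)
              `^ (2 * k%:R)^-1
          * (n%:R^-1) `^ (p^-1 + inv_max2 q - 2^-1))%:E)%E.
Proof.
exists 288; split=> // X p lambda q k n [x x0] p1 l1 q1 k2 n2.
have n0 : (0 < n)%N by exact: leq_trans n2.
have k0 : (0 < k)%N by exact: leq_trans k2.
have nR : 0 < n%:R :> R by rewrite ltr0n.
have kR : 0 < k%:R :> R by rewrite ltr0n.
have p0 : 0 < p by lra.
have [Q [Q12 Qinv] hball] := @lq_ball_embedding R n q n0 q1.
have [e he] := random_form n0 k0 Q12.
set M := n%:R `^ _ in hball.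
have M0 : 0 < M by rewrite powR_gt0.
pose F : R := (k`!)%:R `^ (1 - inv_min2 q).
have F0 : 0 < F by rewrite powR_gt0// ltr0n fact_gt0.
pose B := 18 * (8 * M) ^+ k * Num.sqrt (k%:R * n%:R) * F.
have B0 : 0 <= B.
  by rewrite !mulr_ge0 ?exprn_ge0 ?mulr_ge0 ?sqrtr_ge0// ltW.
apply: ge_ereal_sup => _ [r hr <-]; rewrite lee_fin.
have hB (z : 'rV[R[i]]_n) : lq_ball q z ->
    rnorm (\sum_(a : multi_index n k) (-1) ^+ e a *
      ((multinomial a)%:R * \prod_i z 0 i ^+ mi_entry a i)) <= B.
  move=> hz; rewrite /B /F -Qinv; apply: (he M (fun i => z 0 i)) => //.
  exact: hball.
have hS := bohr_radii_power_sum p1 l1 q1 B0 x0 hB hr.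
have [r0 _] := hr.
apply: le_trans (mean_le_of_power_sum n0 k0 p1 r0 hS) _.
have l0 : 0 <= lambda by lra.
(* The power [p] on [B] cancels the outer root, so [1/p] survives only on [lambda] and [n]. *)
have -> : ((lambda * B `^ p) `^ k%:R^-1 / n%:R) `^ p^-1 =
    lambda `^ (p * k%:R)^-1 * B `^ k%:R^-1 * n%:R^-1 `^ p^-1.
  rewrite powRM ?powR_ge0 ?invr_ge0 ?ler0n//; congr (_ * _).
  rewrite powRM ?powR_ge0// powRM ?powR_ge0//; congr (_ * _).
    by rewrite -powRrM invfM mulrC.
  by rewrite -!powRrM mulrCA mulfV ?mulr1// gt_eqF.
have hroot := root_random_bound k2 n0 M0 F0.
have -> : (k`!)%:R `^ (2 * (1 - inv_min2 q)) = F `^ 2 by rewrite /F -powRrM mulrC.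
(* The embedding radius [M] supplies the part [inv_max2 q - 2^-1] of the exponent, the power mean
   the part [p^-1]. *)
have -> : n%:R^-1 `^ (p^-1 + inv_max2 q - 2^-1) = M * n%:R^-1 `^ p^-1.
  have nV : n%:R^-1 != 0 :> R by rewrite invr_eq0 gt_eqF.
  rewrite -addrA powRD ?nV ?implybT//.
  rewrite mulrC; congr (_ * _).
  by rewrite /M -powR_inv1 ?ler0n// -powRrM; congr (_ `^ _); ring.
rewrite mulrA; apply: ler_wpM2r; first exact: powR_ge0.
set V := _ `^ (2 * k%:R)^-1 in hroot *.
rewrite (_ : 288 * _ * _ * _ = lambda `^ (p * k%:R)^-1 * (288 * M * V)); last by ring.
by apply: ler_wpM2l hroot; exact: powR_ge0.
Qed.
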